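(* Let $k\le n$ be positive integers and let $\mathbb F$ be a field with at least $n+k-1$ elements. Then $J_{n,k}\subseteq \mathbf T(Z_{n,k})$.
   Context: $\mathbb F[\mathbf x_n]=\mathbb F[x_1,\dots,x_n]$. $h_d(x_1,\dots,x_i)=\sum_{1\le j_1\le\cdots\le j_d\le i}x_{j_1}\cdots x_{j_d}$ is the complete homogeneous symmetric polynomial and $e_d(\mathbf x_n)=e_d(x_1,\dots,x_n)$ the elementary symmetric polynomial. $J_{n,k}\subseteq\mathbb F[\mathbf x_n]$ is the ideal generated by $h_k(x_1),h_k(x_1,x_2),\dots,h_k(x_1,\dots,x_n)$ and $e_n(\mathbf x_n),e_{n-1}(\mathbf x_n),\dots,e_{n-k+1}(\mathbf x_n)$. Fix distinct elements $\alpha_1,\dots,\alpha_{n+k-1}\in\mathbb F$. $Z_{n,k}\subseteq\mathbb F^n$ is the set of points $(z_1,\dots,z_n)$ such that $z_i\in\{\alpha_1,\dots,\alpha_{k+i-1}\}$ for each $1\le i\le n$, the coordinates $z_1,\dots,z_n$ are pairwise distinct, and $\{\alpha_1,\dots,\alpha_k\}\subseteq\{z_1,\dots,z_n\}$. For a finite $Z\subseteq\mathbb F^n$, $\mathbf I(Z)$ is the ideal of polynomials vanishing on $Z$; for nonzero $f$, $\tau(f)$ denotes its top-degree homogeneous component; and $\mathbf T(Z)$ is the ideal generated by $\{\tau(f): f\in\mathbf I(Z)\setminus\{0\}\}$. *)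

(* Defs.v *)
(* Multivariate polynomials are not available in the installed
   libraries, so we represent a polynomial in F[x_0,...,x_{n-1}] by a finite
   list of terms (coefficient, exponent vector); the polynomial denoted is the
   one whose coefficient at monomial m is [coef p m] (sum of the coefficients of
   all terms with exponent m). *)
From HB Require Import structures.
From mathcomp Require Import all_boot all_order all_algebra.
Set Implicit Arguments. Unset Strict Implicit. Unset Printing Implicit Defensive.
Import Order.TTheory GRing.Theory Num.Theory.
Local Open Scope ring_scope.

Section MPoly.
Variables (F : fieldType) (n : nat).

Definition monom := {ffun 'I_n -> nat}.
Definition mpoly := seq (F * monom).

Definition mdeg (m : monom) : nat := (\sum_(i < n) m i)%N.
Definition madd (m1 m2 : monom) : monom := [ffun i => (m1 i + m2 i)%N].

Definition coef (p : mpoly) (m : monom) : F := \sum_(t <- p | t.2 == m) t.1.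

Definition padd (p q : mpoly) : mpoly := p ++ q.
Definition pmul (p q : mpoly) : mpoly :=
  [seq (t.1 * u.1, madd t.2 u.2) | t <- p, u <- q].

Definition peq (p q : mpoly) : Prop := forall m, coef p m = coef q m.

Definition pnonzero (p : mpoly) : Prop := exists m, coef p m != 0.

Definition peval (p : mpoly) (z : 'I_n -> F) : F :=
  \sum_(t <- p) t.1 * \prod_(i < n) z i ^+ t.2 i.

Definition pdeg (p : mpoly) : nat := \max_(t <- p | coef p t.2 != 0) mdeg t.2.
Definition tau (p : mpoly) : mpoly := [seq t <- p | mdeg t.2 == pdeg p].

Definition in_ideal (S : mpoly -> Prop) (g : mpoly) : Prop :=
  exists hs : seq (mpoly * mpoly),
    (forall x, x \in hs -> S x.2) /\
    peq g (flatten [seq pmul x.1 x.2 | x <- hs]).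

Definition vanishing_ideal (Z : ('I_n -> F) -> Prop) (f : mpoly) : Prop :=
  forall z, Z z -> peval f z = 0.
Definition T_ideal (Z : ('I_n -> F) -> Prop) : mpoly -> Prop :=
  in_ideal (fun g => exists f, [/\ vanishing_ideal Z f, pnonzero f & g = tau f]).

(* h_d(x_1,...,x_i): sum of all monomials of degree d in the first i variables
   (0-indexed: variables x_j with j < i) *)
Definition hcomplete (d i : nat) : mpoly :=
  [seq (1, [ffun j => nat_of_ord (m j)] : monom)
   | m : {ffun 'I_n -> 'I_d.+1} <- enum [pred m : {ffun 'I_n -> 'I_d.+1} |
     ((\sum_(j < n) nat_of_ord (m j))%N == d) && [forall j : 'I_n, (i <= j)%N ==> (nat_of_ord (m j) == 0%N)]]].

Definition elem (d : nat) : mpoly :=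
  [seq (1, [ffun j => nat_of_bool (j \in A)] : monom) | A : {set 'I_n} <- enum [pred A : {set 'I_n} | #|A| == d]].

Definition J_gens (k : nat) (g : mpoly) : Prop :=
  (exists i, [/\ (1 <= i)%N, (i <= n)%N & g = hcomplete k i]) \/
  (exists d, [/\ (n - k + 1 <= d)%N, (d <= n)%N & g = elem d]).
Definition J_ideal (k : nat) : mpoly -> Prop := in_ideal (J_gens k).

(* Z_{n,k} for distinct alpha_1..alpha_{n+k-1}, stored 0-indexed as
   alpha : 'I_(n+k-1) -> F.  Coordinate i (0-indexed) must lie in
   {alpha_0,...,alpha_(k+i-1)} (i.e. index < k + i). *)
Definition Z_set (k : nat) (alpha : 'I_(n + k - 1) -> F) (z : 'I_n -> F) : Prop :=
  [/\ (forall i : 'I_n, exists j : 'I_(n + k - 1), (nat_of_ord j < k + i)%N /\ z i = alpha j),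
      injective z &
      (forall j : 'I_(n + k - 1), (nat_of_ord j < k)%N -> exists i, z i = alpha j)].

End MPoly.

(* Main.v *)
(* Every generator g of J_{n,k} is the top-degree component of a polynomial
   g + (lower terms) vanishing on Z_{n,k}.

   For g = h_k(x_1,...,x_i), the lower terms are those of the factorial complete
   homogeneous polynomial h_k(x_1,...,x_i | alpha), defined by the recursion of
   h_k with x_i replaced by x_i - alpha_(i+k-1).  Its value at z is the divided
   difference at z_1,...,z_i of prod_(l <= k+i-1) (X - alpha_l), which vanishes when
   the z_j are distinct roots of that polynomial, as they are for z in Z_{n,k}.

   For g = e_d with d > n - k, take sum_(d' <= d) c_(d-d') e_(d'), where the c_j
   are the coefficients of the inverse of prod_(l <= k) (1 + alpha_l X) truncated
   at degree n.  Its value at z is the coefficient of X^d in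
   prod_j (1 + z_j X) * c(X); since alpha_1,...,alpha_k occur among the z_j, this
   product equals a polynomial of degree <= n - k plus terms of degree > n. *)

Require Import Defs.
From HB Require Import structures.
From mathcomp Require Import all_boot all_order all_algebra.
From mathcomp Require Import ring zify.
Set Implicit Arguments. Unset Strict Implicit. Unset Printing Implicit Defensive.
Import Order.TTheory GRing.Theory Num.Theory.
Local Open Scope ring_scope.

Section TermLists.
Variables (F : fieldType) (n : nat).
Implicit Types (p q : mpoly F n) (m : monom n) (z : 'I_n -> F).

Definition meval z m : F := \prod_(i < n) z i ^+ m i.

Lemma peval_cat p q z : peval (p ++ q) z = peval p z + peval q z.
Proof. by rewrite /peval big_cat. Qed.

Lemma peval_flatten (ps : seq (mpoly F n)) z :
  peval (flatten ps) z = \sum_(p <- ps) peval p z.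
Proof.
elim: ps => [|p ps IH] /=; first by rewrite /peval !big_nil.
by rewrite peval_cat IH big_cons.
Qed.

Lemma coef_cat p q m : coef (p ++ q) m = coef p m + coef q m.
Proof. by rewrite /coef big_cat. Qed.

Lemma coef_nil m : coef ([::] : mpoly F n) m = 0.
Proof. by rewrite /coef big_nil. Qed.

Lemma coef_notin p m : m \notin map snd p -> coef p m = 0.
Proof.
move=> hm; rewrite /coef big1_seq // => t /andP [/eqP ht tp].
by move: hm; rewrite -ht map_f.
Qed.

Lemma coef_uniq p t : uniq (map snd p) -> t \in p -> coef p t.2 = t.1.
Proof.
elim: p => [|u p IH] //= /andP [hu up]; rewrite in_cons => /orP [/eqP ->|tp].
  rewrite /coef big_cons eqxx -[RHS]addr0; congr (_ + _); exact: coef_notin hu.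
rewrite /coef big_cons ifF; first exact: IH.
by apply/negbTE; apply: contra hu => /eqP ->; exact: map_f.
Qed.

Lemma peval_coef p z (s : seq (monom n)) : uniq s -> {subset map snd p <= s} ->
  peval p z = \sum_(m <- s) coef p m * meval z m.
Proof.
move=> us sub; rewrite /peval.
transitivity (\sum_(t <- p) \sum_(m <- s) (if t.2 == m then t.1 * meval z m else 0)).
  apply: eq_big_seq => t tp.
  rewrite -[RHS]big_mkcond /= -[RHS]big_filter.
  have -> : [seq i <- s | t.2 == i] = [:: t.2].
    rewrite -(filter_pred1_uniq us (sub _ (map_f _ tp))).
    by apply: eq_filter => x /=; rewrite eq_sym.
  by rewrite big_seq1.
rewrite exchange_big; apply: eq_bigr => m _.
by rewrite /coef mulr_suml [RHS]big_mkcond.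
Qed.

Lemma eq_peval p q z : peq p q -> peval p z = peval q z.
Proof.
move=> epq; set s := undup (map snd (p ++ q)).
have us : uniq s by exact: undup_uniq.
have sub r : r \in [:: p; q] -> {subset map snd r <= s}.
  by rewrite !inE => /orP [] /eqP -> x hx; rewrite mem_undup map_cat mem_cat hx ?orbT.
rewrite (peval_coef z us (sub p _)) ?(peval_coef z us (sub q _)) ?inE ?eqxx ?orbT //.
by apply: eq_bigr => m _; rewrite epq.
Qed.

Definition pscale (c : F) p : mpoly F n := [seq (c * t.1, t.2) | t <- p].

Lemma peval_pscale c p z : peval (pscale c p) z = c * peval p z.
Proof. by rewrite /peval big_map mulr_sumr; apply: eq_bigr => t _ /=; rewrite mulrA. Qed.

Definition monX (i : nat) : monom n := [ffun j : 'I_n => nat_of_bool (val j == i)].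

Definition pmulX (i : nat) p : mpoly F n := [seq (t.1, madd (monX i) t.2) | t <- p].

Lemma meval_monX (i : 'I_n) z m : meval z (madd (monX i) m) = z i * meval z m.
Proof.
rewrite /meval; under eq_bigr do rewrite !ffunE exprD.
rewrite big_split /= (bigD1 i) //= eqxx expr1 big1 ?mulr1 // => j /negbTE ji.
by rewrite val_eqE ji expr0.
Qed.

Lemma peval_pmulX (i : 'I_n) p z : peval (pmulX i p) z = z i * peval p z.
Proof.
rewrite /peval big_map mulr_sumr; apply: eq_bigr => t _ /=.
by rewrite -/(meval z _) meval_monX mulrCA.
Qed.

Definition mdec (m : monom n) (i : 'I_n) : monom n :=
  [ffun j => if j == i then (m j).-1 else m j].

Lemma coef_pmulX (i : 'I_n) p m :
  coef (pmulX i p) m = if (0 < m i)%N then coef p (mdec m i) else 0.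
Proof.
rewrite /coef big_map /=; case: posnP => hm.
  rewrite big1 // => t /eqP ht.
  by move: hm; rewrite -ht !ffunE eqxx.
apply: eq_bigl => t /=; apply/eqP/eqP => [<-|->]; apply/ffunP => j; rewrite !ffunE.
  by rewrite val_eqE; case: eqP => [->|]; rewrite ?eqxx.
by rewrite val_eqE; case: (j =P i) => [->|_] /=; lia.
Qed.

Lemma mdeg_madd m1 m2 : mdeg (madd m1 m2) = (mdeg m1 + mdeg m2)%N.
Proof. by rewrite /mdeg -big_split; apply: eq_bigr => j _; rewrite ffunE. Qed.

Lemma mdeg_monX i : (mdeg (monX i) <= 1)%N.
Proof.
rewrite /mdeg; case: (ltnP i n) => [lt_in|le_ni].
  rewrite (bigD1 (Ordinal lt_in)) //= ffunE eqxx big1 // => j ji.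
  rewrite ffunE; case: eqP => // ij; case/eqP: ji; exact: val_inj.
rewrite big1 // => j _; rewrite ffunE; case: eqP => // ji.
by move: (ltn_ord j); rewrite ji ltnNge le_ni.
Qed.

Lemma mdeg_mdec m i : (0 < m i)%N -> mdeg m = (mdeg (mdec m i)).+1.
Proof.
move=> hm; rewrite /mdeg (bigD1 i) //= [in RHS](bigD1 i) //= ffunE eqxx.
rewrite -addSn prednK //; congr (_ + _)%N.
by apply: eq_bigr => j /negbTE hj; rewrite ffunE hj.
Qed.

Lemma mdeg_eq0 m : (mdeg m == 0%N) = [forall j, m j == 0%N].
Proof. by rewrite /mdeg sum_nat_eq0. Qed.

Lemma tau_cat_lower (g L : mpoly F n) (D : nat) :
  (forall t, t \in g -> mdeg t.2 = D) -> (forall t, t \in L -> (mdeg t.2 < D)%N) ->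
  pnonzero g -> tau (g ++ L) = g /\ pnonzero (g ++ L).
Proof.
move=> hg hL [m hm].
have [t tg tm] : exists2 t, t \in g & t.2 = m.
  case: (boolP (m \in map snd g)) => [/mapP [t tg ->]|hm']; first by exists t.
  by move: hm; rewrite coef_notin ?eqxx.
have coef_top m' : mdeg m' = D -> coef (g ++ L) m' = coef g m'.
  move=> hm'; rewrite coef_cat [coef L m']coef_notin ?addr0 //.
  by apply/mapP => -[u /hL + eu]; rewrite -eu hm' ltnn.
have hmD : mdeg m = D by rewrite -tm hg.
have pdegE : pdeg (g ++ L) = D.
  apply/eqP; rewrite eqn_leq; apply/andP; split.
    apply/bigmax_leqP_seq => u; rewrite mem_cat => /orP [/hg -> //|/hL /ltnW //].
  rewrite -{1}hmD -tm; apply: leq_bigmax_seq; first by rewrite mem_cat tg.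
  by rewrite tm coef_top.
split; last by exists m; rewrite coef_top.
rewrite /tau pdegE filter_cat (eq_in_filter (a2 := predT)); last by move=> u /hg /= ->; rewrite eqxx.
rewrite filter_predT (eq_in_filter (a2 := pred0)) ?filter_pred0 ?cats0 // => u /hL /=.
by rewrite ltn_neqAle => /andP [/negbTE].
Qed.

Definition T_gen (Z : ('I_n -> F) -> Prop) (g : mpoly F n) : Prop :=
  exists f, [/\ vanishing_ideal Z f, pnonzero f & g = tau f].

Lemma T_gen_cat_lower (Z : ('I_n -> F) -> Prop) (g L : mpoly F n) (D : nat) :
  (forall t, t \in g -> mdeg t.2 = D) -> (forall t, t \in L -> (mdeg t.2 < D)%N) ->
  pnonzero g -> vanishing_ideal Z (g ++ L) -> T_gen Z g.
Proof.
move=> hg hL g_nz vanZ; have [tauE nz] := tau_cat_lower hg hL g_nz.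
by exists (g ++ L).
Qed.

Lemma in_ideal_sub (S1 S2 : mpoly F n -> Prop) g :
  (forall h, S1 h -> S2 h) -> in_ideal S1 g -> in_ideal S2 g.
Proof. by move=> S12 [hs [hS eg]]; exists hs; split=> // x /hS /S12. Qed.

End TermLists.

Lemma modp_monic_small (F : fieldType) (w p : {poly F}) (d : nat) :
  w \is monic -> size w = d.+1 -> (size p <= d.+1)%N -> p %% w = p - (p`_d)%:P * w.
Proof.
move=> w_monic sw sp.
have wd : w`_d = 1 by move/monicP: w_monic; rewrite /lead_coef sw.
rewrite -{1}(subrK ((p`_d)%:P * w) p) addrC modp_addl_mul_small // sw ltnS.
apply/leq_sizeP => j; rewrite leq_eqVlt => /orP [/eqP <-|dj].
  by rewrite coefB coefCM wd mulr1 subrr.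
have wj : w`_j = 0 by apply: (leq_sizeP _ _ _ j dj); rewrite sw.
by rewrite coefB coefCM wj mulr0 subr0 (leq_sizeP _ _ sp j dj).
Qed.

Section DividedDifferences.
Variables (F : fieldType) (zs a : nat -> F).

Definition newton (i : nat) : {poly F} := \prod_(j < i) ('X - (zs j)%:P).

(* The leading coefficient of the interpolant of p at zs 0, ..., zs (i - 1). *)
Definition divdiff (p : {poly F}) (i : nat) : F := (p %% newton i)`_i.-1.

Lemma newton_monic i : newton i \is monic. Proof. exact: monic_prod_XsubC. Qed.

Lemma newtonS i : newton i.+1 = newton i * ('X - (zs i)%:P).
Proof. by rewrite /newton big_ord_recr. Qed.

Lemma size_newton i : size (newton i) = i.+1.
Proof.
elim: i => [|i IH]; first by rewrite /newton big_ord0 size_poly1.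
by rewrite newtonS size_Mmonic ?monicXsubC ?monic_neq0 ?newton_monic // IH size_XsubC addn2.
Qed.

Lemma divdiff0 p : divdiff p 0 = 0.
Proof. by rewrite /divdiff /newton big_ord0 modp1 coef0. Qed.

Lemma divdiff_mulXsubC (c : F) q i :
  divdiff (('X - c%:P) * q) i.+1 = (zs i - c) * divdiff q i.+1 + divdiff q i.
Proof.
rewrite /divdiff /=; set r := q %% newton i.+1.
have sr : (size r <= i.+1)%N.
  by rewrite -ltnS -(size_newton i.+1) ltn_modp monic_neq0 ?newton_monic.
have modiE : q %% newton i = r - (r`_i)%:P * newton i.
  rewrite -(modp_monic_small (newton_monic i) (size_newton i) sr).
  have dvd_i : (q %/ newton i.+1 * newton i.+1) %% newton i = 0.
    by rewrite newtonS mulrCA modp_mulr.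
  by rewrite {1}(divp_eq q (newton i.+1)) modpD dvd_i add0r.
have sXr : (size (('X - c%:P) * r)%R <= i.+2)%N.
  by rewrite (leq_trans (size_polyMleq _ _)) // size_XsubC; case: (size r) sr.
have modSiE : (('X - c%:P) * q) %% newton i.+1 =
              ('X - c%:P) * r - (r`_i)%:P * newton i.+1.
  rewrite -modp_mul -/r (modp_monic_small (newton_monic _) (size_newton _) sXr).
  by rewrite mulrBl coefB coefXM coefCM /= (leq_sizeP _ _ sr i.+1) // mulr0 subr0.
rewrite modSiE modiE newtonS !(mulrBl, mulrBr, coefB, coefMX, coefXM, coefCM, coefMC).
have topi : (newton i)`_i = 1.
  by move/monicP: (newton_monic i); rewrite /lead_coef size_newton.
rewrite topi; clearbody r; case: (i =P 0%N) topi => [-> t0|_ _] /=.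
  by rewrite t0; ring.
by ring.
Qed.

Definition aprod (m : nat) : {poly F} := \prod_(l < m) ('X - (a l)%:P).

Lemma aprodS m : aprod m.+1 = ('X - (a m)%:P) * aprod m.
Proof. by rewrite /aprod big_ord_recr mulrC. Qed.

Fixpoint hfact (i k : nat) : F :=
  match i with
  | 0 => if k is 0 then 1 else 0
  | i'.+1 => (fix hfact_i k := match k with
              | 0 => 1
              | k'.+1 => hfact i' k + (zs i' - a (i' + k')) * hfact_i k'
              end) k
  end.

Lemma hfactS0 i : hfact i.+1 0 = 1. Proof. by []. Qed.
Lemma hfactSS i k : hfact i.+1 k.+1 = hfact i k.+1 + (zs i - a (i + k)) * hfact i.+1 k.
Proof. by []. Qed.

Lemma divdiff_aprod m i :
  divdiff (aprod m) i = if (i <= m.+1)%N then hfact i (m.+1 - i) else 0.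
Proof.
elim: m i => [|m IH] [|i].
- by rewrite divdiff0.
- rewrite /divdiff /aprod big_ord0 modp_small; last by rewrite size_poly1 size_newton.
  by rewrite coefC; case: i.
- by rewrite divdiff0 subn0.
rewrite aprodS divdiff_mulXsubC !IH.
case: (ltngtP i m.+1) => [lt_im|lt_mi|->].
- have le_im : (i <= m)%N by rewrite -ltnS.
  rewrite ifT; last by rewrite ltnS ltnW.
  by rewrite !subSS subSn // hfactSS subnKC // addrC.
- by rewrite ifF ?mulr0 ?addr0 // ltnS leqNgt lt_mi.
- by rewrite ltnSn subnn subSS subnn hfactS0 mulr0 add0r.
Qed.

Lemma divdiff_aprod_eq0 m i :
  {in gtn i &, injective zs} -> (forall j, (j < i)%N -> exists2 l, (l < m)%N & zs j = a l) ->
  divdiff (aprod m) i = 0.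
Proof.
move=> zs_inj zs_roots.
have [q ->] : exists q, aprod m = q * \prod_(z <- [seq zs j | j <- iota 0 i]) ('X - z%:P).
  apply: uniq_roots_prod_XsubC.
    apply/allP => x /mapP [j]; rewrite mem_iota add0n => /= hj ->.
    have [l hl ->] := zs_roots j hj.
    by rewrite /root /aprod horner_prod (bigD1 (Ordinal hl)) //= hornerXsubC subrr mul0r.
  rewrite uniq_rootsE map_inj_in_uniq ?iota_uniq // => x y.
  by rewrite !mem_iota !add0n; exact: zs_inj.
rewrite /divdiff /newton big_map -(big_mkord xpredT (fun j => 'X - (zs j)%:P)) /index_iota subn0.
by rewrite modp_mull coef0.
Qed.

Lemma hfact_eq0 i k : (0 < i)%N -> (0 < k)%N -> {in gtn i &, injective zs} ->
  (forall j, (j < i)%N -> exists2 l, (l < k + i - 1)%N & zs j = a l) -> hfact i k = 0.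
Proof.
move=> i_gt0 k_gt0 zs_inj zs_roots.
have := divdiff_aprod_eq0 zs_inj zs_roots; rewrite divdiff_aprod.
have -> : (k + i - 1).+1 = (k + i)%N by lia.
by rewrite leq_addl addnK.
Qed.

End DividedDifferences.

Definition ord_ext (T : Type) (x0 : T) (m : nat) (f : 'I_m -> T) (j : nat) : T :=
  if insub j is Some o then f o else x0.

Lemma ord_extE (T : Type) (x0 : T) (m : nat) (f : 'I_m -> T) (o : 'I_m) :
  ord_ext x0 f o = f o.
Proof. by rewrite /ord_ext valK. Qed.

Section CompleteHomogeneous.
Variables (F : fieldType) (n : nat).
Implicit Types (m : monom n) (z : 'I_n -> F).

Definition hmonom (d i : nat) m : bool :=
  (mdeg m == d) && [forall j : 'I_n, (i <= j)%N ==> (m j == 0%N)].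

Lemma coef_hcomplete d i m : coef (hcomplete F n d i) m = (hmonom d i m)%:R.
Proof.
rewrite /coef /hcomplete big_map /= big_enum_cond /=.
have sumE (x : {ffun 'I_n -> 'I_d.+1}) :
  (\sum_(j < n) nat_of_ord (x j))%N = mdeg [ffun j => nat_of_ord (x j)].
  by rewrite /mdeg; apply: eq_bigr => j _; rewrite ffunE.
case hm: (hmonom d i m).
  have md j : (m j < d.+1)%N.
    rewrite ltnS; move/andP: hm => [/eqP <- _].
    by rewrite /mdeg (bigD1 j) //= leq_addr.
  pose x0 : {ffun 'I_n -> 'I_d.+1} := [ffun j => Ordinal (md j)].
  have x0E : [ffun j => nat_of_ord (x0 j)] = m by apply/ffunP => j; rewrite !ffunE.
  rewrite (big_pred1 x0) // => x /=; apply/andP/eqP => [[_ /eqP xm]|->].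
    by apply/ffunP => j; apply: val_inj; rewrite ffunE /= -xm ffunE.
  split; last by rewrite x0E.
  move: hm; rewrite /hmonom -{1}x0E -sumE => /andP [sd /forallP hf].
  by rewrite inE /= sd; apply/forallP => j; move: (hf j); rewrite -x0E ffunE.
rewrite big_pred0 // => x /=; apply/negbTE/negP => /andP [/andP [hs hf] /eqP xm].
move/negbT: hm; rewrite /hmonom -xm -sumE hs /=; apply/negP/negPn/forallP => j.
by rewrite ffunE; exact: (forallP hf j).
Qed.

Lemma mdeg_hcomplete d i t : t \in hcomplete F n d i -> mdeg t.2 = d.
Proof.
move=> /mapP [x]; rewrite mem_enum => /andP [/eqP hs _] -> /=.
by rewrite /mdeg; under eq_bigr do rewrite ffunE.
Qed.

Lemma hcompleteS (i : 'I_n) d :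
  peq (hcomplete F n d.+1 i.+1) (hcomplete F n d.+1 i ++ pmulX i (hcomplete F n d i.+1)).
Proof.
move=> m; rewrite coef_cat coef_pmulX !coef_hcomplete.
case: posnP => [mi0|mi_gt0].
  rewrite addr0; congr (_%:R); rewrite /hmonom; congr andb.
  apply: eq_forallb => j; case: (j =P i) => [->|/eqP ji]; first by rewrite ltnn leqnn mi0.
  by rewrite (leq_eqVlt i) (_ : (i == j :> nat) = false) //; apply/negbTE; rewrite eq_sym.
have -> : hmonom d.+1 i m = false.
  by apply/negbTE; rewrite negb_and; apply/orP; right; apply/forallP => /(_ i);
     rewrite leqnn /= => /eqP mi0; rewrite mi0 in mi_gt0.
rewrite add0r /hmonom (mdeg_mdec mi_gt0) eqSS; congr (_%:R); congr andb.
by apply: eq_forallb => j; rewrite ffunE; case: (j =P i) => [->|_]; rewrite ?ltnn.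
Qed.

Lemma peval_hcompleteS (i : 'I_n) d z :
  peval (hcomplete F n d.+1 i.+1) z =
  peval (hcomplete F n d.+1 i) z + z i * peval (hcomplete F n d i.+1) z.
Proof. by rewrite -peval_pmulX -peval_cat; apply/eq_peval/hcompleteS. Qed.

Lemma peval_hcomplete0 i z : peval (hcomplete F n 0 i) z = 1.
Proof.
pose m0 : monom n := [ffun _ => 0%N].
have -> : 1 = peval [:: (1 : F, m0)] z.
  by rewrite /peval big_seq1 mul1r big1 // => j _; rewrite ffunE expr0.
apply: eq_peval => m; rewrite coef_hcomplete /coef big_cons big_nil /hmonom /=.
have m0E : (mdeg m == 0%N) = (m == m0).
  by rewrite mdeg_eq0; apply/forallP/eqP => [h|-> j]; [apply/ffunP => j; rewrite ffunE; exact/eqP|rewrite ffunE].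
rewrite m0E eq_sym; case: eqP => [<-|_] //=.
by rewrite addr0 (_ : [forall j, _] = true) //; apply/forallP => j; rewrite ffunE implybT.
Qed.

Lemma peval_hcompleteS0 d z : peval (hcomplete F n d.+1 0) z = 0.
Proof.
have -> : 0 = peval ([::] : mpoly F n) z by rewrite /peval big_nil.
apply: eq_peval => m; rewrite coef_hcomplete coef_nil /hmonom.
case: (boolP [forall j : 'I_n, _]) => [/forallP h|]; last by rewrite andbF.
suff /eqP -> : mdeg m == 0%N by [].
by rewrite mdeg_eq0; apply/forallP => j; exact: (implyP (h j)).
Qed.

Variable a : nat -> F.

(* The terms of degree < k of h_k(x_0,...,x_(i-1) | a), following the recursion of [hfact]. *)
Fixpoint hlower (i k : nat) : mpoly F n :=
  match i with
  | 0 => [::]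
  | i'.+1 => (fix hlower_i k := match k with
      | 0 => [::]
      | k'.+1 => hlower i' k ++ pmulX i' (hlower_i k') ++
                 pscale (- a (i' + k')) (hcomplete F n k' i ++ hlower_i k')
      end) k
  end.

Lemma hlowerSS i k : hlower i.+1 k.+1 =
  hlower i k.+1 ++ pmulX i (hlower i.+1 k) ++
  pscale (- a (i + k)) (hcomplete F n k i.+1 ++ hlower i.+1 k).
Proof. by []. Qed.

Lemma mdeg_hlower i k t : t \in hlower i k -> (mdeg t.2 < k)%N.
Proof.
elim: i k t => [|i IHi] // k t; elim: k t => [|k IHk] // t.
rewrite hlowerSS !mem_cat => /orP [/IHi //|/orP [|]].
  move=> /mapP [u /IHk hu ->] /=; rewrite mdeg_madd -addnS -(add1n k).
  exact: leq_add (mdeg_monX _ _) hu.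
move=> /mapP [u]; rewrite mem_cat => /orP [/mdeg_hcomplete|/IHk /ltnW] hu -> //=.
by rewrite hu.
Qed.

Lemma peval_hcomplete_hlower z i k : (i <= n)%N ->
  peval (hcomplete F n k i ++ hlower i k) z = hfact (ord_ext 0 z) a i k.
Proof.
elim: i k => [|i IHi] k le_in.
  by case: k => [|k]; rewrite cats0 ?peval_hcomplete0 ?peval_hcompleteS0.
elim: k => [|k IHk]; first by rewrite cats0 peval_hcomplete0.
rewrite hfactSS hlowerSS -IHi ?(ltnW le_in) // -IHk.
rewrite !peval_cat (peval_hcompleteS (Ordinal le_in)) (peval_pmulX (Ordinal le_in)).
by rewrite peval_pscale !peval_cat -(ord_extE 0 z (Ordinal le_in)) /=; ring.
Qed.

End CompleteHomogeneous.

Lemma hcomplete_nonzero (F : fieldType) (n d i : nat) :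
  (0 < i <= n)%N -> pnonzero (hcomplete F n d i).
Proof.
case/andP=> i_gt0 le_in; have n_gt0 : (0 < n)%N := leq_trans i_gt0 le_in.
pose m0 : monom n := [ffun j : 'I_n => if val j == 0%N then d else 0%N].
exists m0; rewrite coef_hcomplete; suff -> : hmonom d i m0 by rewrite oner_neq0.
apply/andP; split.
  rewrite /mdeg (bigD1 (Ordinal n_gt0)) //= ffunE /= big1 ?addn0 // => j j0.
  rewrite ffunE; case: (val j =P 0%N) => // j0'; case/eqP: j0; exact: val_inj.
apply/forallP => j; apply/implyP => le_ij; rewrite ffunE.
case: (val j =P 0%N) => [j0|//]; move: le_ij; rewrite j0 leqn0 => /eqP i0.
by rewrite i0 in i_gt0.
Qed.

Section ElementarySymmetric.
Variables (F : fieldType) (n : nat).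
Implicit Types (z : 'I_n -> F).

Definition esym z d : F := \sum_(A : {set 'I_n} | #|A| == d) \prod_(j in A) z j.

Definition egen (I : finType) (z : I -> F) : {poly F} := \prod_(j : I) ((z j)%:P * 'X + 1).

Lemma peval_elem d z : peval (elem F n d) z = esym z d.
Proof.
rewrite /peval /elem big_map big_enum /=; apply: eq_bigr => A _.
rewrite mul1r (bigID (mem A)) /= [X in _ * X]big1 ?mulr1.
  by apply: eq_bigr => j jA; rewrite ffunE jA expr1.
by move=> j /negbTE jA; rewrite ffunE jA expr0.
Qed.

Lemma mdeg_elem d t : t \in elem F n d -> mdeg t.2 = d.
Proof.
move=> /mapP [A]; rewrite mem_enum => /eqP <- -> /=.
rewrite /mdeg -sum1_card [RHS]big_mkcond /=; apply: eq_bigr => j _.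
by rewrite ffunE; case: (j \in A).
Qed.

Lemma elem_nonzero d : (d <= n)%N -> pnonzero (elem F n d).
Proof.
move=> le_dn; pose A : {set 'I_n} := [set widen_ord le_dn j | j : 'I_d].
have cardA : #|A| = d.
  by rewrite card_imset ?card_ord // => i j /(congr1 val) ij; exact: val_inj.
pose t := (1 : F, [ffun j => nat_of_bool (j \in A)] : monom n).
exists t.2; rewrite coef_uniq ?oner_neq0 //; last by apply/mapP; exists A => //; rewrite mem_enum inE cardA.
rewrite /elem -map_comp map_inj_in_uniq ?enum_uniq // => B C _ _ /= /ffunP BC.
by apply/setP => j; move: (BC j); rewrite !ffunE; case: (j \in B); case: (j \in C).
Qed.

Lemma coef_egen z d : (egen z)`_d = esym z d.
Proof.
rewrite /egen bigA_distr coef_sum /esym [RHS]big_mkcond /=; apply: eq_bigr => A _.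
have -> : \prod_(j < n) (if j \in A then (z j)%:P * 'X else 1) =
          (\prod_(j in A) z j)%:P * 'X^#|A|.
  by rewrite -big_mkcond /= big_split /= prodr_const rmorph_prod.
by rewrite coefCM coefXn eq_sym; case: eqP => _; rewrite ?mulr1 ?mulr0.
Qed.

Lemma peval_elem_egen (c : {poly F}) d z : c`_0 = 1 ->
  peval (elem F n d ++ flatten [seq pscale c`_(d - d') (elem F n d') | d' <- iota 0 d]) z
  = (egen z * c)`_d.
Proof.
move=> c0; rewrite peval_cat peval_flatten big_map coefM big_ord_recr /= subnn c0 mulr1.
rewrite coef_egen peval_elem addrC; congr (_ + _).
rewrite -(big_mkord xpredT (fun j => (egen z)`_j * c`_(d - j))) /index_iota subn0.
by apply: eq_bigr => d' _; rewrite peval_pscale peval_elem coef_egen mulrC.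
Qed.

Variable k : nat.

(* The inverse of [egen b] truncated at degree n. *)
Definition egen_inv (b : 'I_k -> F) : {poly F} :=
  \prod_(l < k) \sum_(r < n.+1) ((- b l)%:P * 'X) ^+ r.

Lemma coef0_egen_inv b : (egen_inv b)`_0 = 1.
Proof.
rewrite /egen_inv coef0_prod; apply: big1 => l _.
rewrite coef_sum big_ord_recl /= expr0 coefC /= big1 ?addr0 // => r _.
by rewrite exprMn -rmorphXn coefCM coefXn /= mulr0.
Qed.

Lemma egen_mul_inv b : exists Q, egen b * egen_inv b = 1 + 'X^(n.+1) * Q.
Proof.
rewrite /egen /egen_inv -big_split /=.
apply: (big_ind (fun p => exists Q, p = 1 + 'X^(n.+1) * Q)).
- by exists 0; rewrite mulr0 addr0.
- by move=> p1 p2 [Q1 ->] [Q2 ->]; exists (Q1 + Q2 + 'X^(n.+1) * Q1 * Q2); ring.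
move=> l _; exists (- ((- b l)%:P ^+ n.+1)).
have -> : (b l)%:P * 'X + 1 = - ((- b l)%:P * 'X - 1) by rewrite polyCN; ring.
by rewrite mulNr -subrX1 exprMn; ring.
Qed.

(* If z takes all values of b, then egen z = egen b * R with deg R <= n - k, so
   egen z * egen_inv b = R + X^(n+1) * R * Q has no terms in degrees (n-k, n]. *)
Lemma coef_egen_mul_inv_eq0 (b : 'I_k -> F) z d :
  injective b -> (forall l, exists i, z i = b l) -> (n - k < d <= n)%N ->
  (egen z * egen_inv b)`_d = 0.
Proof.
move=> b_inj z_onto /andP [lt_nkd le_dn].
have z_onto' l : exists i, z i == b l by have [i <-] := z_onto l; exists i.
pose s l := xchoose (z_onto' l).
have zsE l : z (s l) = b l by exact: eqP (xchooseP (z_onto' l)).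
have s_inj : injective s by move=> l1 l2 e; apply: b_inj; rewrite -!zsE e.
pose S := [set s l | l : 'I_k].
have cardS : #|S| = k by rewrite card_imset // card_ord.
rewrite /egen (bigID (mem S)) /=.
have -> : \prod_(j < n | j \in S) ((z j)%:P * 'X + 1) = egen b.
  by rewrite (big_imset _ (in2W s_inj)) /=; apply: eq_bigr => l _; rewrite zsE.
set R := \prod_(j < n | j \notin S) _.
have sizeR : (size R <= (n - k).+1)%N.
  have cardP : #|[pred j | j \notin S]| = (n - k)%N.
    have <- : #|~: S| = (n - k)%N by rewrite cardsCs setCK card_ord cardS.
    by apply: eq_card => j; rewrite !inE.
  have size_factor j : (size ((z j)%:P * 'X + 1)%R <= 2)%N.
    by rewrite -polyC1 size_MXaddC; case: ifP => // _; rewrite ltnS size_polyC leq_b1.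
  apply: leq_trans (size_poly_prod_leq _ _) _; rewrite cardP leq_subLR.
  have : (\sum_(j < n | j \notin S) size ((z j)%:P * 'X + 1)%R <= 2 * (n - k))%N.
    by rewrite -cardP mulnC -sum_nat_const leq_sum.
  by move=> h; rewrite addnS ltnS addnn -mul2n.
have [Q invE] := egen_mul_inv b.
rewrite mulrAC invE mulrDl mul1r -mulrA coefD coefXnM ltnS le_dn addr0.
exact: (leq_sizeP _ _ sizeR d lt_nkd).
Qed.

End ElementarySymmetric.

Section Lifts.
Variables (F : fieldType) (n k : nat) (alpha : 'I_(n + k - 1) -> F).

Lemma T_gen_hcomplete i : (0 < k)%N -> (0 < i <= n)%N ->
  T_gen (Z_set alpha) (hcomplete F n k i).
Proof.
move=> k_gt0 /andP [i_gt0 le_in].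
apply: (T_gen_cat_lower (@mdeg_hcomplete F n k i) (@mdeg_hlower F n (ord_ext 0 alpha) i k)).
  by apply: hcomplete_nonzero; rewrite i_gt0.
move=> z [z_in z_inj _]; rewrite peval_hcomplete_hlower //.
have ltn_jn j : (j < i)%N -> (j < n)%N by move/leq_trans; apply.
apply: hfact_eq0 => // [j1 j2 /ltn_jn lt1 /ltn_jn lt2|j lt_ji].
  rewrite -[j1]/(val (Ordinal lt1)) -[j2]/(val (Ordinal lt2)) !ord_extE.
  by move/z_inj/(congr1 val).
have lt_jn := ltn_jn j lt_ji; have [l [lt_l zE]] := z_in (Ordinal lt_jn).
exists (val l); last by rewrite -[j]/(val (Ordinal lt_jn)) ord_extE zE ord_extE.
by move: lt_l => /=; lia.
Qed.

Lemma T_gen_elem d : injective alpha -> (k <= n)%N -> (n - k < d <= n)%N ->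
  T_gen (Z_set alpha) (elem F n d).
Proof.
move=> alpha_inj le_kn /andP [lt_d le_dn].
have le_k : (k <= n + k - 1)%N by lia.
pose b (l : 'I_k) := alpha (widen_ord le_k l).
have b_inj : injective b by move=> l1 l2 /alpha_inj /(congr1 val) e; exact: val_inj.
pose c := egen_inv n b.
pose L := flatten [seq pscale c`_(d - d') (elem F n d') | d' <- iota 0 d].
have deg_L t : t \in L -> (mdeg t.2 < d)%N.
  move=> /flattenP [p /mapP [d' + ->] /mapP [u /mdeg_elem + ->]] /=.
  by rewrite mem_iota => /andP [_ lt_d'] ->.
apply: (T_gen_cat_lower (@mdeg_elem F n d) deg_L (elem_nonzero F le_dn)).
move=> z [_ _ z_onto]; rewrite peval_elem_egen ?coef0_egen_inv //.
apply: coef_egen_mul_inv_eq0 => //; last by rewrite lt_d le_dn.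
by move=> l; exact: z_onto (widen_ord le_k l) (ltn_ord l).
Qed.

End Lifts.

Theorem mainTheorem3 (F : fieldType) (n k : nat) (hk : (1 <= k)%N) (hkn : (k <= n)%N)
    (alpha : 'I_(n + k - 1) -> F) (halpha : injective alpha) :
  forall g : mpoly F n, J_ideal k g -> T_ideal (Z_set alpha) g.
Proof.
move=> g; apply: in_ideal_sub => _ [[i [i_gt0 le_in ->]] | [d [lt_d le_dn ->]]].
  by apply: T_gen_hcomplete => //; rewrite i_gt0.
by apply: T_gen_elem => //; rewrite le_dn andbT; lia.
Qed.
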